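(* Suppose $\Sigma=\{a<b\}$ and $w\in\Sigma^\ast$. Then $$\Psi_\Sigma([w])=\begin{pmatrix}1 & |w|_a & \dfrac{|w|_a|w|_b}{2}\\ 0 & 1 & |w|_b\\ 0 & 0 & 1\end{pmatrix}.$$
   Context: $\Sigma^\ast$ is the set of all finite words over $\Sigma$, including the empty word $\lambda$. For a letter $a\in\Sigma$, $|w|_a$ is the number of occurrences of $a$ in $w$. $\Sigma=\{a<b\}$ denotes an ordered alphabet with two distinct letters $a,b$ and order $a<b$. Cyclic shifts: for $w=c_1c_2\cdots c_n$ (letters $c_i$) and $0\le i\le n-1$, the $i$-th cyclic shift of $w$ is $c_{i+1}\cdots c_nc_1\cdots c_i$. The circular word $[w]$ is the set (equivalence class) of all distinct words that are cyclic shifts of $w$ (with $[\lambda]=\{\lambda\}$); $|[w]|$ is its cardinality. Parikh matrix of a linear word: for an ordered alphabet $\Sigma=\{a_1<a_2<\cdots<a_s\}$, $\Psi_\Sigma$ is the monoid morphism from $\Sigma^\ast$ to the $(s+1)\times(s+1)$ matrices under multiplication such that $\Psi_\Sigma(\lambda)$ is the identity matrix and, for $1\le q\le s$, $\Psi_\Sigma(a_q)$ is the matrix with $1$'s on the main diagonal, a $1$ in position $(q,q+1)$, and $0$ elsewhere. Parikh matrix of a circular word: $\Psi_\Sigma([w])=\frac{1}{|[w]|}\sum_{u\in[w]}\Psi_\Sigma(u)$ (a matrix with rational entries). *)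

(* Defs.v *)
From mathcomp Require Import all_boot all_order all_algebra.
Set Implicit Arguments.
Unset Strict Implicit.
Unset Printing Implicit Defensive.
Import GRing.Theory.
Local Open Scope ring_scope.

(* An ordered alphabet a_1 < ... < a_s is encoded by the sequence
   [:: a_1; ...; a_s] of its letters, assumed pairwise distinct; a word over it
   is a w : seq T with {subset w <= Sigma}. *)

(* Rows, columns and letters are numbered from 0 here, so that the off-diagonal
   1 of the matrix of a_q, in position (q, q+1) counting from 1, lies in row
   index a_q Sigma = q-1. *)
Definition letter_parikh_mx (T : eqType) (Sigma : seq T) (c : T) :
    'M[rat]_((size Sigma).+1) :=
  \matrix_(i, j) ((i == j) ||
                  ((i == index c Sigma :> nat) && (j == i.+1 :> nat)))%:R.

Definition parikh_mx (T : eqType) (Sigma : seq T) (w : seq T) :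
    'M[rat]_((size Sigma).+1) :=
  \prod_(c <- w) letter_parikh_mx Sigma c.

(* The finite set [w], as a duplicate-free sequence. *)
Definition circular_word (T : eqType) (w : seq T) : seq (seq T) :=
  if w is [::] then [:: [::]]
  else undup [seq rot i w | i <- iota 0 (size w)].

(* The argument C is a circular word, given as the set of its
   representatives. *)
Definition circular_parikh_mx (T : eqType) (Sigma : seq T) (C : seq (seq T)) :
    'M[rat]_((size Sigma).+1) :=
  (size C)%:R^-1 *: \sum_(u <- C) parikh_mx Sigma u.

(* Main.v *)
Require Import Defs.
From mathcomp Require Import all_boot all_order all_algebra.
From mathcomp Require Import ring.
Set Implicit Arguments.
Unset Strict Implicit.
Unset Printing Implicit Defensive.
Import GRing.Theory.
Local Open Scope ring_scope.

(** The only entry of the matrix that varies inside a circular word is the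
    upper right one, which for a linear word [u] counts the pairs of an
    [a] followed, at any distance, by a [b].  Over a binary alphabet this count
    is an affine function of the positions of the letters [a]: an [a] at
    position [i] (from 0) in a word of length [n] is followed by [n - 1 - i]
    letters, and those among them that are again [a] account, in total over
    all occurrences of [a], for [|u|_a (|u|_a - 1) / 2] pairs
    ([parikh_mx_binary]).

    Hence the mean over the circular word of [w] only depends on how often, for
    each position [i], the letter [a] stands at position [i] of one of its
    elements.  Rotation by one letter permutes the circular word
    ([perm_rot1_circular_word]), so this frequency does not depend on [i]; as the
    frequencies add up to [|w|_a], each of them is [|w|_a / n]
    ([sum_letter_at]).  Since the numbers
    [n - 1 - i] add up to [n (n - 1) / 2], the mean of the count is
    [|w|_a (n - 1) / 2 - |w|_a (|w|_a - 1) / 2 = |w|_a |w|_b / 2].  As the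
    sums run over the set of distinct shifts itself, the period of [w] never
    enters. *)

(** * Unitriangular matrices of size 3 *)

Definition unitri3 (x y z : rat) : 'M[rat]_3 :=
  \matrix_(i < 3, j < 3)
    (nth [::] [:: [:: 1; x; z]; [:: 0; 1; y]; [:: 0; 0; 1]] i)`_j.

Lemma unitri3_mul x y z x' y' z' :
  unitri3 x y z * unitri3 x' y' z' =
  unitri3 (x + x') (y + y') (z + x * y' + z').
Proof.
apply/matrixP => i j; rewrite !mxE !big_ord_recl big_ord0 !mxE.
by case: i => [[|[|[|i]]] Hi] //; case: j => [[|[|[|j]]] Hj] //=; ring.
Qed.

Lemma unitri3_1 : 1 = unitri3 0 0 0.
Proof.
apply/matrixP => i j; rewrite !mxE.
by case: i => [[|[|[|i]]] Hi] //; case: j => [[|[|[|j]]] Hj].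
Qed.

Lemma mean_unitri3 (I : eqType) (s : seq I) x y (z : I -> rat) :
  (0 < size s)%N ->
  (size s)%:R^-1 *: \sum_(u <- s) unitri3 x y (z u) =
  unitri3 x y ((size s)%:R^-1 * \sum_(u <- s) z u).
Proof.
move=> s_gt0.
have mean_cst c : (size s)%:R^-1 * (\sum_(u <- s) c) = c :> rat.
  rewrite big_const_seq count_predT iter_addr_0 -[c *+ _]mulr_natl mulKf //.
  by rewrite Num.Theory.pnatr_eq0 -lt0n.
apply/matrixP => i j; rewrite mxE summxE.
under eq_bigr do rewrite mxE.
rewrite !mxE.
by case: i => [[|[|[|i]]] Hi] //; case: j => [[|[|[|j]]] Hj] //=;
  rewrite mean_cst.
Qed.

(** * The Parikh matrix of a linear binary word *)

Lemma letter_parikh_mx_binary (T : eqType) (a b c : T) :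
  a != b -> c \in [:: a; b] ->
  letter_parikh_mx [:: a; b] c = unitri3 (c == a)%:R (c == b)%:R 0.
Proof.
move=> ab; rewrite !inE => /orP[]/eqP->; apply/matrixP => i j; rewrite !mxE /=.
  rewrite eqxx (negPf ab).
  by case: i => [[|[|[|i]]] Hi] //; case: j => [[|[|[|j]]] Hj].
rewrite eqxx [b == a]eq_sym (negPf ab).
by case: i => [[|[|[|i]]] Hi] //; case: j => [[|[|[|j]]] Hj].
Qed.

Lemma count_binary (T : eqType) (a b : T) (u : seq T) :
  a != b -> {subset u <= [:: a; b]} ->
  (count_mem a u + count_mem b u)%N = size u.
Proof.
move=> ab sub; rewrite -[RHS](count_predC (pred1 a)); congr addn.
apply: eq_in_count => c /sub; rewrite !inE => /orP[]/eqP->; rewrite eqxx //=.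
  exact: negPf.
by rewrite eq_sym ab.
Qed.

(** The number of pairs of positions [i < j] of [u] such that [a] stands at [i],
    minus the number of those such that [a] stands at both: over a binary
    alphabet, the number of occurrences of [ab] as a scattered subword. *)
Definition scattered_ab (T : eqType) (x0 a : T) (u : seq T) : rat :=
  \sum_(i < size u) (nth x0 u i == a)%:R * (size u - i.+1)%:R
  - (count_mem a u)%:R * ((count_mem a u)%:R - 1) / 2%:R.

(** A new first letter [a] forms a new pair with each letter [b] of [v], that is
    with [size v] letters except the letters [a]; this is the increment of
    both terms of [scattered_ab]. *)
Lemma scattered_ab_cons (T : eqType) (x0 a c : T) (v : seq T) :
  scattered_ab x0 a (c :: v) =
  (c == a)%:R * ((size v)%:R - (count_mem a v)%:R) + scattered_ab x0 a v.
Proof.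
rewrite /scattered_ab /= big_ord_recl /= subn1 /=.
under eq_bigr do rewrite /= /bump /= add1n subSS.
by case: (c == a); rewrite ?natrD /=; field.
Qed.

Lemma parikh_mx_binary (T : eqType) (a b : T) (u : seq T) :
  a != b -> {subset u <= [:: a; b]} ->
  parikh_mx [:: a; b] u =
  unitri3 (count_mem a u)%:R (count_mem b u)%:R (scattered_ab b a u).
Proof.
move=> ab; elim: u => [|c v IHv] sub.
  by rewrite /parikh_mx /scattered_ab big_nil /= big_ord0 !mul0r subr0 unitri3_1.
have sub_v : {subset v <= [:: a; b]}.
  by move=> d dv; apply: sub; rewrite inE dv orbT.
have c_ab : c \in [:: a; b] by apply: sub; rewrite mem_head.
rewrite /parikh_mx big_cons -/(parikh_mx _ v) IHv //.
rewrite letter_parikh_mx_binary // unitri3_mul scattered_ab_cons /= !natrD.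
rewrite -(count_binary ab sub_v) natrD.
by congr unitri3; ring.
Qed.

(** * Circular words *)

Lemma sum_nth_eq (T : eqType) (x0 a : T) (u : seq T) :
  \sum_(i < size u) (nth x0 u i == a)%:R = (count_mem a u)%:R :> rat.
Proof.
elim: u => [|c v IHv]; first by rewrite big_ord0.
by rewrite big_ord_recl /= IHv natrD.
Qed.

Lemma sum_letters_after (n : nat) :
  \sum_(i < n) (n - i.+1)%:R = n%:R * (n%:R - 1) / 2%:R :> rat.
Proof.
elim: n => [|n IHn]; first by rewrite big_ord0 !mul0r.
rewrite big_ord_recl /= subn1 /=.
under eq_bigr do rewrite /bump /= add1n subSS.
by rewrite IHn -(natr1 n); field.
Qed.

Lemma circular_wordP (T : eqType) (w u : seq T) :
  reflect (exists i, u = rot i w) (u \in circular_word w).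
Proof.
case: w => [|c v].
  by rewrite inE; apply: (iffP eqP) => [->|[i ->]]; [exists 0%N|].
rewrite mem_undup; apply: (iffP mapP) => [[i _ ->]|[i ->]]; first by exists i.
have [lt_i|ge_i] := ltnP i (size (c :: v)).
  by exists i; rewrite ?mem_iota.
by exists 0%N; rewrite ?mem_iota // rot0 rot_oversize.
Qed.

Lemma circular_word_uniq (T : eqType) (w : seq T) : uniq (circular_word w).
Proof. by case: w => // c v; apply: undup_uniq. Qed.

Lemma size_circular_word_gt0 (T : eqType) (w : seq T) :
  (0 < size (circular_word w))%N.
Proof.
have: w \in circular_word w by apply/circular_wordP; exists 0%N; rewrite rot0.
by case: (circular_word w).
Qed.

Lemma perm_circular_word (T : eqType) (w u : seq T) :
  u \in circular_word w -> perm_eq u w.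
Proof. by case/circular_wordP => i ->; rewrite perm_rot. Qed.

Lemma perm_rot1_circular_word (T : eqType) (w : seq T) :
  perm_eq [seq rot 1 u | u <- circular_word w] (circular_word w).
Proof.
have uniq_rot : uniq [seq rot 1 u | u <- circular_word w].
  by rewrite map_inj_uniq ?circular_word_uniq //; apply: rot_inj.
have sub : {subset [seq rot 1 u | u <- circular_word w] <= circular_word w}.
  move=> _ /mapP[_ /circular_wordP[i ->] ->]; apply/circular_wordP.
  have [lt_i|ge_i] := ltnP i (size w); first by exists i.+1; rewrite -rotS.
  by exists 1%N; rewrite (rot_oversize ge_i).
(* An injective map from a finite set to itself is onto. *)
have [|_ eq_mem] := uniq_min_size uniq_rot sub; first by rewrite size_map.
exact: uniq_perm uniq_rot (circular_word_uniq w) eq_mem.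
Qed.

(** Position [i] of [rot 1 u] is position [i.+1] of [u], and the sum is
    invariant under rotating all the elements [u]. *)
Lemma sum_letter_at_succ (T : eqType) (x0 a : T) (w : seq T) (i : nat) :
  (i.+1 < size w)%N ->
  \sum_(u <- circular_word w) (nth x0 u i.+1 == a)%:R =
  \sum_(u <- circular_word w) (nth x0 u i == a)%:R :> rat.
Proof.
move=> lt_i; rewrite -[RHS](perm_big _ (perm_rot1_circular_word w)) big_map.
rewrite big_seq [RHS]big_seq; apply: eq_bigr => u /perm_circular_word/perm_size.
case: u => [|c v] /= size_u; first by rewrite -size_u in lt_i.
by rewrite rot1_cons nth_rcons -ltnS size_u lt_i.
Qed.

(** By [sum_letter_at_succ] the sum has the same value at every position [i];
    summing over [i] as well and exchanging the two sums, each element of the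
    circular word contributes [|w|_a]. *)
Lemma sum_letter_at (T : eqType) (x0 a : T) (w : seq T) (i : nat) :
  (i < size w)%N ->
  \sum_(u <- circular_word w) (nth x0 u i == a)%:R =
  (size (circular_word w))%:R * (count_mem a w)%:R / (size w)%:R :> rat.
Proof.
set f := fun i => \sum_(u <- circular_word w) (nth x0 u i == a)%:R : rat.
have f_cst j : (j < size w)%N -> f j = f 0%N.
  elim: j => // j IHj lt_j; rewrite /f sum_letter_at_succ //.
  exact: IHj (ltnW lt_j).
move=> lt_i; rewrite -/(f i) f_cst //.
have size_neq0 : (size w)%:R != 0 :> rat.
  by rewrite Num.Theory.pnatr_eq0 -lt0n (leq_ltn_trans _ lt_i).
have total : \sum_(j < size w) f j =
    (size (circular_word w))%:R * (count_mem a w)%:R.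
  rewrite exchange_big /= big_seq (eq_bigr (fun=> (count_mem a w)%:R)).
    rewrite -big_seq big_const_seq count_predT iter_addr_0.
    by rewrite mulr_natl.
  move=> u /perm_circular_word perm_u.
  by rewrite -(perm_size perm_u) sum_nth_eq (permP perm_u).
rewrite -total (eq_bigr (fun=> f 0%N)); last by move=> j _; apply: f_cst.
by rewrite sumr_const card_ord -[_ *+ _]mulr_natr mulfK.
Qed.

Lemma sum_scattered_ab (T : eqType) (x0 a : T) (w : seq T) :
  \sum_(u <- circular_word w) scattered_ab x0 a u =
  (size (circular_word w))%:R
  * ((count_mem a w)%:R * ((size w)%:R - (count_mem a w)%:R) / 2%:R).
Proof.
pose n := size w; pose k : rat := (count_mem a w)%:R.
pose N : rat := (size (circular_word w))%:R.
transitivity (\sum_(u <- circular_word w)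
    (\sum_(i < n) (nth x0 u i == a)%:R * (n - i.+1)%:R - k * (k - 1) / 2%:R)).
  apply: eq_big_seq => u /perm_circular_word perm_u.
  by rewrite /scattered_ab (perm_size perm_u) (permP perm_u).
rewrite sumrB exchange_big /= big_const_seq count_predT iter_addr_0.
rewrite (eq_bigr (fun i : 'I_n => N * k / n%:R * (n - i.+1)%:R)); last first.
  by move=> i _; rewrite -mulr_suml sum_letter_at.
rewrite -mulr_sumr sum_letters_after -[(_ / _) *+ _]mulr_natl -/N -/k -/n.
(* The division by [n] is legitimate unless [w] is empty; then [k] is 0. *)
have [n0|n_gt0] := posnP n.
  have -> : k = 0 by rewrite /k (size0nil n0).
  by rewrite !(mulr0, mul0r) subrr.
have n_neq0 : n%:R != 0 :> rat by rewrite Num.Theory.pnatr_eq0 -lt0n.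
by field.
Qed.

Theorem theorem4p11 (T : eqType) (a b : T) (w : seq T)
    (hab : a != b) (hw : {subset w <= [:: a; b]}) :
  circular_parikh_mx [:: a; b] (circular_word w) =
  \matrix_(i < 3, j < 3)
    (nth [::]
      [:: [:: 1; (count_mem a w)%:R; (count_mem a w)%:R * (count_mem b w)%:R / 2%:R];
          [:: 0; 1;                  (count_mem b w)%:R];
          [:: 0; 0;                  1]] i)`_j :> 'M[rat]_3.
Proof.
rewrite -/(unitri3 _ _ _) /circular_parikh_mx.
have parikhE u : u \in circular_word w -> parikh_mx [:: a; b] u =
    unitri3 (count_mem a w)%:R (count_mem b w)%:R (scattered_ab b a u).
  move=> /perm_circular_word perm_u; rewrite parikh_mx_binary //.
    by rewrite !(permP perm_u).
  by move=> c; rewrite (perm_mem perm_u); apply: hw.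
rewrite (eq_big_seq _ parikhE) mean_unitri3 ?size_circular_word_gt0 //.
congr unitri3; rewrite sum_scattered_ab mulKf; last first.
  by rewrite Num.Theory.pnatr_eq0 -lt0n size_circular_word_gt0.
by rewrite -(count_binary hab hw) natrD addrAC subrr add0r.
Qed.
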